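(* Let $(X,q)$ be a $\delta$-symmetric quasi-metric space, let $N\in\mathbb{N}$, and let $\{X;w_1,\dots,w_N\}$ be an iterated function system where each $w_i:X\to X$ is an $f$-Proinov-type $\mathcal{Z}$-contraction with respect to the simulation function $\xi_i$ and control functions $\zeta$ and $\eta_i$ (with $\zeta$ common to all $i$); that is, each $w_i$ satisfies $0\le\xi_i\big(\zeta(q(w_i(x),w_i(y))),\eta_i(q(x,y))\big)$ for all $x,y\in X$. Suppose that: (i) each $\xi_i(s,t)$ decreases in the first variable and increases in the second variable, for $i=1,\dots,N$; (ii) $\zeta,\eta_i$ are nondecreasing for each $i=1,\dots,N$; (iii) $\eta_i(t)<\zeta(t)$ for all $t\in \mathrm{Im}(q)\setminus\{0\}$ and $i=1,\dots,N$; (iv) if $\{x_n\}$ and $\{y_n\}$ are two sequences in $(0,\infty)$ such that $\lim_{n\to\infty}x_n=\lim_{n\to\infty}y_n>0$, then $\lim_{n\to\infty}\zeta(x_n)=\lim_{n\to\infty}\zeta(y_n)>0$. Then the fractal operator $W$ generated by $\{X;w_1,\dots,w_N\}$ has a unique attractor $A^*\in\mathcal{H}_f(X)$, i.e. a unique $A^*\in\mathcal{H}_f(X)$ with $W(A^* )=A^*$. Moreover, the iterated sequence $\{W^n(A)\}$ converges to the attractor $A^*$ in $(\mathcal{H}_f(X),h_q)$ for any $A\in\mathcal{H}_f(X)$.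
   Context: A quasi-metric on a nonempty set $X$ is a function $q:X\times X\to\mathbb{R}$ such that for all $x,y,z\in X$: $q(x,y)\ge 0$; $q(x,y)=0$ if and only if $x=y$; $q(x,y)\le q(x,z)+q(z,y)$. The space $(X,q)$ is $\delta$-symmetric if there exists $\delta>0$ with $q(x,y)\le\delta q(y,x)$ for all $x,y\in X$. $\mathrm{Im}(q)$ denotes the range of $q$. The forward topology $\tau_f$ on $X$ has as basis the balls $B_f(x,r)=\{y\in X:q(x,y)<r\}$, $x\in X$, $r>0$. $\mathcal{H}_f(X)$ is the collection of all nonempty $f$-compact subsets of $X$ (compact subsets of $(X,\tau_f)$), with the metric $h_q(A,B)=\max\{Q(A,B),Q(B,A)\}$, where $Q(A,B)=\sup_{x\in A}\inf_{y\in B}q(x,y)$. The fractal operator generated by $\{X;w_1,\dots,w_N\}$ is $W:\mathcal{H}_f(X)\to\mathcal{H}_f(X)$, $W(A)=\bigcup_{i=1}^N w_i(A)$. A simulation function is a map $\xi:[0,\infty)\times[0,\infty)\to\mathbb{R}$ such that: ($z_1$) $\xi(0,0)=0$; ($z_2$) $\xi(s,t)<t-s$ for all $s,t>0$; ($z_3$) for any sequences $\{s_n\},\{t_n\}$ in $(0,\infty)$ with $\lim_{n\to\infty}s_n=\lim_{n\to\infty}t_n>0$ one has $\limsup_{n\to\infty}\xi(s_n,t_n)<0$. $\mathcal{Z}$ is the set of all simulation functions. A map $T:X\to X$ is an $f$-Proinov-type $\mathcal{Z}$-contraction with respect to $\xi\in\mathcal{Z}$ if $\xi\big(\zeta(q(Tx,Ty)),\eta(q(x,y))\big)\ge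 0$ for all $x,y\in X$, where $\zeta,\eta:(0,\infty)\to\mathbb{R}$ are two control functions with $\eta(t)<\zeta(t)$ for all $t\in\mathrm{Im}(q)\setminus\{0\}$.
   Formalization: The space (X,q) is additionally assumed complete (every forward Cauchy sequence converges in the forward topology); without this the claim fails, e.g. for w(n)=n+1 on the natural numbers with q(m,n)=|2^-m-2^-n|. *)

(* Defs.v *)
From HB Require Import structures.
From mathcomp Require Import all_boot all_order all_algebra.
From mathcomp Require Import all_classical all_reals all_analysis.

Set Implicit Arguments.
Unset Strict Implicit.
Unset Printing Implicit Defensive.

Import Order.TTheory GRing.Theory Num.Theory.
Import numFieldNormedType.Exports.

Local Open Scope classical_set_scope.
Local Open Scope ring_scope.

Record quasiMetric (R : realType) (X : Type) := QuasiMetric {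
  qdist :> X -> X -> R;
  qdist_ge0 : forall x y, 0 <= qdist x y;
  qdist_eq0 : forall x y, qdist x y = 0 <-> x = y;
  qdist_triangle : forall x y z, qdist x y <= qdist x z + qdist z y
}.

Definition delta_symmetric (R : realType) (X : Type) (q : quasiMetric R X) :=
  exists2 delta : R, 0 < delta & forall x y, q x y <= delta * q y x.

(** The range Im(q). *)
Definition qrange (R : realType) (X : Type) (q : quasiMetric R X) : set R :=
  range (fun p : X * X => q p.1 p.2).

Definition fball (R : realType) (X : Type) (q : quasiMetric R X)
  (x : X) (r : R) : set X := [set y | q x y < r].

(** Copy of [X] that carries the forward topology. *)
Definition forward (R : realType) (X : Type) (q : quasiMetric R X) : Type := X.

Section ForwardTopology.
Variables (R : realType) (X : pointedType) (q : quasiMetric R X).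

HB.instance Definition _ := Pointed.on (forward q).

Let pos : set (X * R) := [set p | 0 < p.2].
Let basic (p : X * R) : set (forward q) := fball q p.1 p.2.

Let basic_cover : \bigcup_(p in pos) basic p = setT.
Proof.
rewrite predeqE => x; split=> // _; exists (x, 1); rewrite /pos /basic /fball /=.
  exact: ltr01.
by rewrite (qdist_eq0 q x x).2 // ltr01.
Qed.

Let basic_join i j t : pos i -> pos j -> basic i t -> basic j t ->
  exists k, [/\ pos k, basic k t & basic k `<=` basic i `&` basic j].
Proof.
case: i j => [x r] [y s]; rewrite /pos /basic /fball /= => _ _ xt yt.
exists (t, Num.min (r - q x t) (s - q y t)); split => /=.
- by rewrite lt_min !subr_gt0 xt yt.
- by rewrite (qdist_eq0 q t t).2 // lt_min !subr_gt0 xt yt.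
- move=> z /=; rewrite lt_min => /andP[ltr lts]; split.
    by apply: (le_lt_trans (qdist_triangle q x z t)); rewrite addrC -ltrBrDr.
  by apply: (le_lt_trans (qdist_triangle q y z t)); rewrite addrC -ltrBrDr.
Qed.

HB.instance Definition _ :=
  @isBaseTopological.Build (forward q) (X * R)%type pos basic
    basic_cover basic_join.

End ForwardTopology.

(** Forward Cauchy sequences and forward convergence; for a delta-symmetric
    quasi-metric the forward and backward notions coincide. *)
Definition f_cauchy (R : realType) (X : Type) (q : quasiMetric R X)
    (u : nat -> X) :=
  forall e : R, 0 < e ->
    exists k : nat, forall m n : nat, (k <= m)%N -> (m <= n)%N ->
      q (u m) (u n) < e.

Definition f_complete (R : realType) (X : pointedType) (q : quasiMetric R X) :=
  forall u : nat -> X, f_cauchy q u ->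
    exists x : forward q, (u : nat -> forward q) @ \oo --> x.

Definition Hf (R : realType) (X : pointedType) (q : quasiMetric R X)
    (A : set X) :=
  A !=set0 /\ @compact (forward q) A.

Definition Qdist (R : realType) (X : Type) (q : quasiMetric R X)
    (A B : set X) : R :=
  sup [set inf [set q x y | y in B] | x in A].

Definition hdist (R : realType) (X : Type) (q : quasiMetric R X)
    (A B : set X) : R :=
  Num.max (Qdist q A B) (Qdist q B A).

Definition Hf_converges (R : realType) (X : pointedType) (q : quasiMetric R X)
    (S : nat -> set X) (A : set X) :=
  [/\ forall n, Hf q (S n), Hf q A &
      (fun n => hdist q (S n) A) @ \oo --> (0 : R)].

Definition fractal_operator (X : Type) (N : nat) (w : 'I_N -> X -> X)
    (A : set X) : set X :=
  \bigcup_(i in [set: 'I_N]) (w i @` A).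

(** A function on [0,oo) x [0,oo) is represented by a function on R x R of which
    only the values at nonnegative arguments are ever constrained or used;
    likewise for control functions, whose domain is (0,oo). *)
Definition simulation_function (R : realType) (xi : R -> R -> R) :=
  [/\ xi 0 0 = 0,
      forall s t, 0 < s -> 0 < t -> xi s t < t - s &
      forall (s t : nat -> R) (l : R),
        (forall n, 0 < s n) -> (forall n, 0 < t n) ->
        s @ \oo --> l -> t @ \oo --> l -> 0 < l ->
        (limn_esup (fun n => (xi (s n) (t n))%:E) < 0)%E].

(** The inequality is imposed where [zeta (q (T x) (T y))] is defined, that is
    for [q (T x) (T y) > 0], which entails [q x y > 0]; membership of the
    arguments in the domain [0,oo) of [xi] is then part of the condition. *)
Definition proinov_Zcontraction (R : realType) (X : Type)
    (q : quasiMetric R X) (xi : R -> R -> R) (zeta eta : R -> R) (T : X -> X) :=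
  (forall t, qrange q t -> t != 0 -> eta t < zeta t) /\
  (forall x y, 0 < q (T x) (T y) ->
     [/\ 0 <= zeta (q (T x) (T y)), 0 <= eta (q x y) &
         0 <= xi (zeta (q (T x) (T y))) (eta (q x y))]).

(* Main.v *)
Require Import Defs.
From mathcomp Require Import all_boot all_order all_algebra.
From mathcomp Require Import all_classical all_reals all_analysis.
From mathcomp Require Import lra.

Set Implicit Arguments.
Unset Strict Implicit.
Unset Printing Implicit Defensive.

Import Order.TTheory GRing.Theory Num.Theory.
Import numFieldNormedType.Exports.

Local Open Scope classical_set_scope.
Local Open Scope ring_scope.

(** The hypotheses on the simulation functions combine into one
    metric fact about the whole family: for every l > 0 there is d > 0 such that
    q x y < l + d forces q (w i x) (w i y) < l - d, for all i at once
    ([gap_contraction]). Were it to fail for one map T at some l, there would be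
    pairs with q (x_n) (y_n) and q (T x_n) (T y_n) both tending to l; then
    zeta (q (T x_n) (T y_n)) and eta (q (x_n) (y_n)) tend to the same positive
    limit, since the second is squeezed between zeta of the two distances, and
    the third axiom of simulation functions contradicts the contraction
    inequality ([proinov_gap]).

    From the gap property everything is obtained on words s in the indices, a
    word acting on X by [foldr w x s]. Long words contract any bounded distance
    below any prescribed e, uniformly in the word ([foldr_shrinks]), and a
    Meir-Keeler argument shows that all images of one point under all words form
    a bounded set ([orbit_bounded_from]). Hence for every infinite sequence u of
    indices the points w_(u 0) (... (w_(u n) x0)) form a Cauchy sequence; its
    limit is the address map pi, which satisfies pi (i u) = w i (pi u)
    ([address_map_exists]). By uniform contraction pi is continuous on the
    product of discrete finite spaces, which is compact by Tychonoff's theorem,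
    so the range of pi is a compact set fixed by the fractal operator: the
    attractor. Applying [foldr_shrinks] to points of two compact sets A and B
    shows that the iterates of A and B approach each other; with B the attractor
    this is convergence, and with A and B both fixed it gives uniqueness,
    compact sets being closed. *)

(** * Compactness and convergence in the forward topology *)

Section ForwardTopologyFacts.
Variables (R : realType) (X : pointedType) (q : quasiMetric R X).

Lemma qdistxx (x : X) : q x x = 0.
Proof. exact/qdist_eq0. Qed.

Lemma nbhs_fball (x : X) (e : R) : 0 < e ->
  nbhs (x : forward q) (fball q x e).
Proof.
move=> e0; apply: open_nbhs_nbhs; split; last by rewrite /fball /= qdistxx.
exists [set (x, e)]; first by move=> _ ->.
by rewrite bigcup_set1.
Qed.

Lemma nbhs_fballP (x : X) (A : set X) :
  nbhs (x : forward q) A <-> exists2 e : R, 0 < e & fball q x e `<=` A.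
Proof.
split=> [|[e e0 sA]]; last exact: filterS sA (nbhs_fball x e0).
rewrite nbhsE => -[B [[D Dpos <-] [[y r] Dyr xyr]] sA].
have r_gt : q y x < r := xyr.
exists (r - q y x); first by rewrite subr_gt0.
move=> z xz; apply: sA; exists (y, r) => //; rewrite /fball /=.
by apply: (le_lt_trans (qdist_triangle q y z x)); rewrite addrC -ltrBrDr.
Qed.

Lemma f_cvgP (u : nat -> X) (x : X) :
  (u : nat -> forward q) @ \oo --> (x : forward q) <->
  forall e : R, 0 < e -> exists n0, forall n, (n0 <= n)%N -> q x (u n) < e.
Proof.
split=> [ux e e0|ux A /nbhs_fballP[e e0 sA]].
  by have [n0 _ H] := ux _ (nbhs_fball x e0); exists n0 => n /H.
by have [n0 H] := ux _ e0; exists n0 => // n /= /H /sA.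
Qed.

Lemma nonexpansive_continuous (T : X -> X) :
  (forall x y, q (T x) (T y) <= q x y) ->
  continuous (T : forward q -> forward q).
Proof.
move=> Tle x A /nbhs_fballP[e e0 sA]; apply/nbhs_fballP; exists e => // y xy.
by apply: sA; exact: le_lt_trans (Tle x y) xy.
Qed.

Variable delta : R.
Hypothesis delta_gt0 : 0 < delta.
Hypothesis q_le : forall x y, q x y <= delta * q y x.

Lemma q_lt_swap (x y : X) (e : R) : q y x < e / delta -> q x y < e.
Proof.
by move=> yx; apply: le_lt_trans (q_le x y) _; rewrite mulrC -ltr_pdivlMr.
Qed.

(** The forward topology alone need not be Hausdorff; comparing q x y with q y x
    makes it so. *)
Lemma f_cvg_unique (u : nat -> X) (x y : X) :
  (u : nat -> forward q) @ \oo --> (x : forward q) ->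
  (u : nat -> forward q) @ \oo --> (y : forward q) -> x = y.
Proof.
move=> /f_cvgP ux /f_cvgP uy; apply/(qdist_eq0 q)/eqP.
rewrite eq_le qdist_ge0 andbT; apply/ler_addgt0Pl => e e0; rewrite addr0.
have [n1 H1] := ux (e / 2) ltac:(lra).
have [n2 H2] := uy (e / 2 / delta) ltac:(by rewrite !divr_gt0).
have := H1 (maxn n1 n2) (leq_maxl _ _).
have := q_lt_swap (H2 (maxn n1 n2) (leq_maxr _ _)).
have := qdist_triangle q x y (u (maxn n1 n2)); lra.
Qed.

(** The balls of centre x and radius r form, as r grows, a directed cover; the
    near-covering form of compactness picks a single radius. *)
Lemma compact_f_bounded (x : X) (A : set X) : @compact (forward q) A ->
  exists M : R, forall y, A y -> q x y <= M.
Proof.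
move=> /compact_near_coveringP cA.
have [|M [_ /(_ (M + 1))]] := cA R (pinfty_nbhs R) (fun r y => q x y <= r) _.
  move=> y _; exists (fball q y 1, [set r | q x y + 1 < r]).
    by split; [exact: nbhs_fball|exact/nbhs_pinfty_gt/num_real].
  move=> [z r] /= [yz rz]; apply: le_trans (qdist_triangle q x z y) _.
  by move: yz; rewrite /fball /=; lra.
by rewrite ltrDl ltr01 => /(_ isT) H; exists (M + 1).
Qed.

Lemma compact_f_bounded2 (A B : set X) :
  @compact (forward q) A -> @compact (forward q) B ->
  exists D : R, forall x y, A x -> B y -> q x y <= D /\ q y x <= D.
Proof.
move=> /(compact_f_bounded point)[M HM] /(compact_f_bounded point)[P HP].
exists ((1 + delta) * (M + P)) => x y /HM xM /HP yP.
have := qdist_triangle q x y point; have := qdist_triangle q y x point.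
have := q_le x point; have := q_le y point.
have := qdist_ge0 q point x; have := qdist_ge0 q point y.
have d0 := delta_gt0; nra.
Qed.

(** If x is outside A, the distance q x y is bounded below by q x y0 / 2 for y
    near each y0 in A, hence uniformly on A by compactness. *)
Lemma compact_f_closed (A : set X) (x : X) : @compact (forward q) A ->
  (forall e : R, 0 < e -> exists2 y, A y & q x y < e) -> A x.
Proof.
move=> /compact_near_coveringP cA Ax; apply: contrapT => nAx.
have [|e /= e0 /(_ (e / 2))] :=
    cA R (0^'+) (fun r y => r <= q x y) _.
  move=> y Ay.
  have xy : 0 < q x y.
    rewrite lt_neqAle qdist_ge0 andbT eq_sym; apply/eqP => /qdist_eq0 xy.
    by apply: nAx; rewrite xy.
  exists (fball q y (q x y / 2 / delta), [set r | r < q x y / 2]).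
    split; first by apply: nbhs_fball; rewrite !divr_gt0.
    by apply: nbhs_right_lt; rewrite divr_gt0.
  move=> [z r] /= [/q_lt_swap zy rz].
  by have := qdist_triangle q x y z; lra.
rewrite /= sub0r normrN ger0_norm; last lra.
move=> /(_ ltac:(lra) ltac:(lra)) H.
have [y /H ey xy] := Ax (e / 2) ltac:(lra).
by move: (lt_le_trans xy ey); rewrite ltxx.
Qed.

End ForwardTopologyFacts.

(** * Bounding the Hausdorff distance *)

Section HausdorffDistance.
Variables (R : realType) (X : Type) (q : quasiMetric R X).

Lemma Qdist_bounds (A B : set X) (e : R) : A !=set0 ->
  (forall x, A x -> exists2 y, B y & q x y <= e) -> 0 <= Qdist q A B <= e.
Proof.
move=> [a Aa] AB.
have lb x : lbound [set q x y | y in B] 0.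
  by move=> _ [y _ <-]; exact: qdist_ge0.
have ub : ubound [set inf [set q x y | y in B] | x in A] e.
  move=> _ [x Ax <-]; have [y By xy] := AB _ Ax.
  by apply: le_trans xy; apply: ge_inf; [exists 0|exists y].
apply/andP; split; last first.
  by apply: ge_sup ub; exists (inf [set q a y | y in B]), a.
have [b Bb _] := AB _ Aa.
apply: (@le_trans _ _ (inf [set q a y | y in B])).
  by apply: lb_le_inf (lb a); exists (q a b), b.
by apply: ub_le_sup; [exists e|exists a].
Qed.

Lemma hdist_cvg0 (S : nat -> set X) (A : set X) :
  (forall n, S n !=set0) -> A !=set0 ->
  (forall e : R, 0 < e -> \forall n \near \oo,
     (forall x, S n x -> exists2 y, A y & q x y <= e) /\
     (forall y, A y -> exists2 x, S n x & q y x <= e)) ->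
  (fun n => hdist q (S n) A) @ \oo --> (0 : R).
Proof.
move=> S0 A0 SA; apply/cvgr0Pnorm_le => e /SA; apply: filterS => n [SAn ASn].
have /andP[h0 h1] := Qdist_bounds (S0 n) SAn.
have /andP[k0 k1] := Qdist_bounds A0 ASn.
by rewrite ger0_norm /hdist ?le_max ?h0 // ge_max h1 k1.
Qed.

End HausdorffDistance.

(** * The space of addresses *)

Definition push_letter (I : Type) (i : I) (u : nat -> I) (n : nat) : I :=
  if n is m.+1 then u m else i.

Lemma mkseq_push (I : Type) (i : I) (u : nat -> I) n :
  mkseq (push_letter i u) n.+1 = i :: mkseq u n.
Proof. by rewrite /mkseq /= -(addn0 1%N) iotaDl -map_comp. Qed.

Lemma push_shift (I : Type) (u : nat -> I) :
  push_letter (u 0%N) (fun n => u n.+1) = u.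
Proof. by apply/funext => -[]. Qed.

(** Named so that it carries the product topology rather than whatever structure
    is found on functions. *)
Definition code_space (I : finType) : topologicalType :=
  prod_topology (fun _ : nat => discrete_topology I).

Lemma code_space_compact (I : finType) : compact [set: code_space I].
Proof.
have := @tychonoff nat (fun=> discrete_topology I) (fun=> setT)
  (fun=> @finite_compact (discrete_topology I) setT (@finite_finset I setT)).
by congr (compact _); rewrite eqEsubset.
Qed.

Lemma nbhs_prefix (I : finType) (u : code_space I) n :
  nbhs u [set v : code_space I |
    mkseq (v : nat -> I) n = mkseq (u : nat -> I) n].
Proof.
elim: n => [|n IHn]; first by apply: filterS filterT => v _.
have un : nbhs u [set v : code_space I | (v : nat -> I) n = (u : nat -> I) n].
  exact: (@proj_continuous nat (fun=> discrete_topology I) n u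
    [set (u : nat -> I) n]).
by apply: filterS2 IHn un => v E1 E2; rewrite /= !mkseqS E1 E2.
Qed.

(** * Families with the gap property *)

(** A uniform strengthening of the Meir-Keeler condition. The radius d is common
    to all maps of the family, and taking x = y shows that d < l. *)
Definition gap_contraction (R : realType) (X : Type) (q : quasiMetric R X)
    (I : Type) (w : I -> X -> X) :=
  forall l : R, 0 < l -> exists2 d : R, 0 < d &
    forall i x y, q x y < l + d -> q (w i x) (w i y) < l - d.

Section GapContractions.
Variables (R : realType) (X : pointedType) (q : quasiMetric R X).
Variables (I : finType) (w : I -> X -> X).
Hypothesis w_gap : gap_contraction q w.

Lemma gap_nonexpansive i x y : q (w i x) (w i y) <= q x y.
Proof.
have [/qdist_eq0 ->|xy] := eqVneq (q x y) 0; first by rewrite qdistxx qdist_ge0.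
have q0 : 0 < q x y by rewrite lt_neqAle eq_sym xy qdist_ge0.
have [d d0 /(_ i x y)] := w_gap q0; lra.
Qed.

Lemma foldr_nonexpansive s x y : q (foldr w x s) (foldr w y s) <= q x y.
Proof.
elim: s => //= i s; apply: le_trans; exact: gap_nonexpansive.
Qed.

(** The bounds r that all long enough words achieve on pairs at distance at most
    D have an infimum l. If l were at least e, hence positive, some achieved
    r < l + d would be turned into l - d by one more letter. *)
Lemma foldr_shrinks (D e : R) : 0 < e -> exists n, forall s, (n <= size s)%N ->
  forall x y, q x y <= D -> q (foldr w x s) (foldr w y s) < e.
Proof.
move=> e0; pose S := [set r : R | exists n, forall s, (n <= size s)%N ->
  forall x y, q x y <= D -> q (foldr w x s) (foldr w y s) <= r].
have [[r [n Hn] re]|noS] := pselect (exists2 r, S r & r < e).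
  by exists n => s ns x y xy; exact: le_lt_trans (Hn s ns x y xy) re.
have lbS : lbound S e.
  by move=> r Sr; rewrite leNgt; apply/negP => re; apply: noS; exists r.
have S0 : S !=set0.
  by exists D, 0%N => s _ x y; exact: le_trans (foldr_nonexpansive s x y).
have [d d0 Hd] := w_gap (lt_le_trans e0 (lb_le_inf S0 lbS)).
have [|r [n Hn] rd] := inf_adherent d0 (conj S0 _); first by exists e.
suff /ge_inf : S (inf S - d) by move=> /(_ (ex_intro _ e lbS)); lra.
exists n.+1 => -[//|i s] ns x y xy /=; apply/ltW/Hd.
exact: le_lt_trans (Hn s ns x y xy) rd.
Qed.

(** Meir-Keeler argument with l = 1: choose n such that words of length n bring
    x0 and w j x0 within d of each other. By induction every longer word sends
    x0 within 1 of the image of x0 under some word of length exactly n: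
    prefixing a letter i contracts the distance to less than 1 - d, and trading
    the resulting word i s for its first n letters costs less than d. *)
Lemma orbit_bounded_from (x0 : X) : exists D : R, forall s,
  q x0 (foldr w x0 s) <= D.
Proof.
pose M := \big[Num.max/0]_(i : I) q x0 (w i x0).
have M0 : 0 <= M by exact: bigmax_ge_id.
have HM i : q x0 (w i x0) <= M by exact: le_bigmax.
have [d d0 Hd] := w_gap (@ltr01 R).
have [n Hn] := foldr_shrinks M d0.
have short s : q x0 (foldr w x0 s) <= M *+ size s.
  elim: s => [|i s IHs] /=; first by rewrite qdistxx.
  rewrite mulrS; apply: le_trans (qdist_triangle q _ _ (w i x0)) _.
  by apply: lerD => //; apply: le_trans IHs; exact: gap_nonexpansive.
have long t : (n <= size t)%N ->
    exists2 s, size s = n & q (foldr w x0 s) (foldr w x0 t) < 1.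
  elim: t => [|i t IHt].
    by rewrite leqn0 => /eqP n0; exists [::]; rewrite // qdistxx ltr01.
  rewrite leq_eqVlt => /orP[/eqP nt|/IHt[s sn st]].
    by exists (i :: t); rewrite // qdistxx ltr01.
  pose s' := belast i s; pose j := last i s.
  have s'n : size s' = n by rewrite size_belast.
  (* i s = s' j, so i s acts on x0 as s' acts on w j x0. *)
  exists s' => //; have := Hd i (foldr w x0 s) (foldr w x0 t) ltac:(lra).
  rewrite -/(foldr w x0 (i :: s)) lastI foldr_rcons /= => st'.
  have := Hn s' ltac:(by rewrite s'n) _ _ (HM j).
  have := qdist_triangle q (foldr w x0 s') (w i (foldr w x0 t))
    (foldr w (w j x0) s').
  by lra.
exists (M *+ n + 1) => s; have [/ltnW sn|/long[t tn ts]] := ltnP (size s) n.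
  apply: le_trans (short s) _.
  by rewrite -(subnKC sn) mulrnDr -addrA lerDl addr_ge0 ?mulrn_wge0.
have := short t; rewrite tn.
by have := qdist_triangle q x0 (foldr w x0 s) (foldr w x0 t); lra.
Qed.

Variable delta : R.
Hypothesis delta_gt0 : 0 < delta.
Hypothesis q_le : forall x y, q x y <= delta * q y x.
Hypothesis q_complete : f_complete q.

(** The later terms are images, under the same first letters, of points of the
    bounded orbit of x0. *)
Lemma address_cvg (x0 : X) (u : nat -> I) : exists x : X,
  (fun n => foldr w x0 (mkseq u n) : forward q) @ \oo --> (x : forward q).
Proof.
apply: q_complete => e e0.
have [D HD] := orbit_bounded_from x0.
have [n Hn] := foldr_shrinks D e0.
exists n => m p nm mp; rewrite -(subnKC mp) /mkseq iotaD map_cat foldr_cat.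
by apply: Hn => //; rewrite size_map size_iota.
Qed.

(** The functional equation follows by comparing limits, w i being
    nonexpansive. Boundedness of pi comes from that of the orbit of x0, each
    pi u being a limit of points of that orbit. *)
Lemma address_map_exists : exists pi : (nat -> I) -> X,
  (forall i u, pi (push_letter i u) = w i (pi u)) /\
  exists D : R, forall u v, q (pi u) (pi v) <= D.
Proof.
pose x0 : X := point; have [pi Hpi] := choice (address_cvg x0).
exists pi; split.
  move=> i u; apply: (f_cvg_unique delta_gt0 q_le (Hpi _)).
  apply/f_cvgP => e e0; have [n0 H] := (f_cvgP _ _ _).1 (Hpi u) e e0.
  exists n0.+1 => -[//|n] nn; rewrite mkseq_push /=.
  exact: le_lt_trans (gap_nonexpansive _ _ _) (H n nn).
have [D HD] := orbit_bounded_from x0.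
exists (1 + delta * D + (D + delta * 1)) => u v.
have [n1 /(_ n1 (leqnn _)) Hu] := (f_cvgP _ _ _).1 (Hpi u) 1 ltr01.
have [n2 /(_ n2 (leqnn _)) Hv] := (f_cvgP _ _ _).1 (Hpi v) 1 ltr01.
move: Hu Hv; set a := foldr _ _ _; set b := foldr _ _ _ => Hu Hv.
have := HD (mkseq u n1); have := HD (mkseq v n2); rewrite -/a -/b => vD uD.
apply: le_trans (qdist_triangle q _ _ x0) _; apply: lerD.
  apply: le_trans (qdist_triangle q _ _ a) _; apply: lerD; first exact: ltW.
  by apply: le_trans (q_le _ _) _; rewrite ler_pM2l.
apply: le_trans (qdist_triangle q _ _ b) _; apply: lerD => //.
by apply: le_trans (q_le _ _) _; rewrite ler_pM2l // ltW.
Qed.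

Section Attractor.
Variable pi : (nat -> I) -> X.
Hypothesis pi_push : forall i u, pi (push_letter i u) = w i (pi u).
Variable D : R.
Hypothesis pi_bounded : forall u v, q (pi u) (pi v) <= D.

Lemma address_prefix u n :
  pi u = foldr w (pi (fun m => u (n + m)%N)) (mkseq u n).
Proof.
elim: n u => [|n IHn] u //.
by rewrite -{1 3}(push_shift u) pi_push mkseq_push /= {1}IHn.
Qed.

(** If u and v share n letters, pi u and pi v are images under one word of
    length n of points at distance at most D, hence close: pi is continuous. *)
Lemma range_address_compact : @compact (forward q) (range pi).
Proof.
apply: (@continuous_compact (code_space I) (forward q) pi);
  last exact: code_space_compact.
apply: continuous_subspaceT => u A /nbhs_fballP[e e0 sA].
have [n Hn] := foldr_shrinks D e0.
apply: filterS (nbhs_prefix u n) => v E; apply: sA.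
rewrite /fball /= (address_prefix u n) (address_prefix v n) E.
by apply: Hn; rewrite ?size_mkseq.
Qed.

End Attractor.

End GapContractions.

(** * The attractor of a family with the gap property *)

Section FractalOperator.
Variables (R : realType) (X : pointedType) (q : quasiMetric R X).
Variables (N : nat) (w : 'I_N -> X -> X).
Hypothesis w_gap : gap_contraction q w.

Lemma iter_fractal_operatorP n (A : set X) x :
  iter n (fractal_operator w) A x <->
  exists s a, [/\ size s = n, A a & x = foldr w a s].
Proof.
elim: n x => [|n IHn] x /=.
  split=> [Ax|[s [a [/size0nil -> ? ->]]]] //; by exists [::], x.
split=> [[i _ [y /IHn[s [a [sn Aa ->]]] <-]]|[[|i s] [a []//]]].
  by exists (i :: s), a; rewrite /= sn.
move=> [sn] Aa ->; exists i => //; exists (foldr w a s) => //.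
by apply/IHn; exists s, a.
Qed.

Lemma Hf_fractal_operator (A : set X) : (0 < N)%N -> Hf q A ->
  Hf q (fractal_operator w A).
Proof.
move=> N0 [[a Aa] cA]; split.
  by exists (w (Ordinal N0) a), (Ordinal N0) => //; exists a.
have -> : fractal_operator w A = \big[setU/set0]_(i <- enum 'I_N) (w i @` A).
  rewrite -bigcup_seq /fractal_operator; congr (bigcup _ _).
  by rewrite eqEsubset; split=> i //= _; rewrite mem_enum.
apply: bigsetU_compact => i _.
apply: (@continuous_compact (forward q) (forward q) (w i)) => //.
apply: continuous_subspaceT; apply: nonexpansive_continuous => x y.
exact: gap_nonexpansive.
Qed.

(** The image under a word of a point of A is close to the image under the same
    word of one chosen point b of B. *)
Lemma iter_fractal_close (A B : set X) (D e : R) : B !=set0 -> 0 < e ->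
  (forall x y, A x -> B y -> q x y <= D) ->
  exists n0, forall n, (n0 <= n)%N ->
  forall x, iter n (fractal_operator w) A x ->
    exists2 y, iter n (fractal_operator w) B y & q x y < e.
Proof.
move=> [b Bb] e0 AB; have [n0 Hn0] := foldr_shrinks w_gap D e0.
exists n0 => n nn x /iter_fractal_operatorP[s [a [sn Aa ->]]].
exists (foldr w b s); first by apply/iter_fractal_operatorP; exists s, b.
by apply: Hn0; [rewrite sn|exact: AB].
Qed.

Lemma gap_contraction_attractor : (0 < N)%N -> delta_symmetric q ->
  f_complete q ->
  exists A' : set X,
    [/\ Hf q A', fractal_operator w A' = A',
        (forall B, Hf q B -> fractal_operator w B = B -> B = A') &
        (forall A, Hf q A ->
           Hf_converges q (fun n => iter n (fractal_operator w) A) A')].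
Proof.
move=> N0 [delta delta_gt0 q_le] q_complete.
have [pi [pi_push [D pi_bounded]]] :=
  address_map_exists w_gap delta_gt0 q_le q_complete.
pose W := fractal_operator w.
have cpi : @compact (forward q) (range pi).
  exact: range_address_compact pi_push D pi_bounded.
have Hpi : Hf q (range pi).
  by split=> //; exists (pi (fun=> Ordinal N0)), (fun=> Ordinal N0).
have Wpi : W (range pi) = range pi.
  rewrite eqEsubset; split=> [_ [i _ [_ [u _ <-] <-]]|_ [u _ <-]].
    by exists (push_letter i u).
  exists (u 0%N) => //; exists (pi (fun n => u n.+1)); first by eexists.
  by rewrite -pi_push push_shift.
have iter_fix B n : W B = B -> iter n W B = B.
  by move=> WB; elim: n => //= n ->.
have close A B e : Hf q A -> Hf q B -> 0 < e -> exists n0,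
    forall n, (n0 <= n)%N -> forall x, iter n W A x ->
    exists2 y, iter n W B y & q x y < e.
  move=> [_ cA] [B0 cB] e0.
  have [M HM] := compact_f_bounded2 delta_gt0 q_le cA cB.
  apply: (@iter_fractal_close A B M) => // x y Ax By.
  by have [] := HM x y Ax By.
have fix_sub A B : Hf q A -> Hf q B -> W A = A -> W B = B -> A `<=` B.
  move=> HA HB WA WB x Ax.
  apply: (compact_f_closed delta_gt0 q_le HB.2) => e e0.
  have [n0 /(_ _ (leqnn _) x)] := close A B e HA HB e0.
  by rewrite (iter_fix A _ WA) (iter_fix B _ WB); apply.
exists (range pi); split=> //.
  move=> B HB WB; rewrite eqEsubset.
  by split; [exact: (fix_sub B)|exact: (fix_sub (range pi))].
move=> A HA.
have HWA n : Hf q (iter n W A) by elim: n => //= n; exact: Hf_fractal_operator.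
split=> //; apply: hdist_cvg0.
- by move=> n; have [] := HWA n.
- by have [] := Hpi.
move=> e e0; have [n1 H1] := close _ _ _ HA Hpi e0.
have [n2 H2] := close _ _ _ Hpi HA e0.
exists (maxn n1 n2) => // n /=; rewrite geq_max => /andP[/H1 AP /H2 PA].
move: AP PA; rewrite (iter_fix _ n Wpi) => AP PA.
by split=> x; [move=> /AP|move=> /PA] => -[y ? /ltW]; exists y.
Qed.

End FractalOperator.

(** * The gap property of Proinov-type contractions *)

(** For t > 0 this is the second axiom. The case t = 0, which that axiom leaves
    open, is excluded by monotonicity: xi s 0 <= xi s (s / 2) < - s / 2. *)
Lemma simulation_ge0_lt (R : realType) (xi : R -> R -> R) (s t : R) :
  simulation_function xi ->
  (forall s t1 t2 : R, 0 <= s -> 0 <= t1 -> t1 <= t2 -> xi s t1 <= xi s t2) ->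
  0 < s -> 0 <= t -> 0 <= xi s t -> s < t.
Proof.
move=> [_ xi_lt _] xi_incr s0 t0 xi0.
have [{}t0|t_le0] := ltP 0 t; first by have := xi_lt _ _ s0 t0; lra.
have := xi_lt s (s / 2) s0 ltac:(lra).
by have := xi_incr s t (s / 2) ltac:(lra) t0 ltac:(lra); lra.
Qed.

(** Argument by contradiction with d = l / (n + 2), which keeps l - d positive,
    so that the contraction inequality applies to every term of the sequences. *)
Lemma proinov_gap (R : realType) (X : pointedType) (q : quasiMetric R X)
    (xi : R -> R -> R) (zeta eta : R -> R) (T : X -> X) :
  simulation_function xi -> proinov_Zcontraction q xi zeta eta T ->
  (forall s t1 t2 : R, 0 <= s -> 0 <= t1 -> t1 <= t2 -> xi s t1 <= xi s t2) ->
  (forall t1 t2 : R, 0 < t1 -> t1 <= t2 -> zeta t1 <= zeta t2) ->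
  (forall (x y : nat -> R) (l : R),
     (forall n, 0 < x n) -> (forall n, 0 < y n) ->
     x @ \oo --> l -> y @ \oo --> l -> 0 < l ->
     exists m : R, [/\ 0 < m, (zeta \o x) @ \oo --> m &
                       (zeta \o y) @ \oo --> m]) ->
  forall l : R, 0 < l -> exists2 d : R, 0 < d &
    forall x y, q x y < l + d -> q (T x) (T y) < l - d.
Proof.
move=> xi_sim [eta_lt T_contr] xi_incr zeta_nd zeta_lim l l0.
(* The limit condition along a constant sequence. *)
have zeta_gt0 t : 0 < t -> 0 < zeta t.
  move=> t0; have [m [m0 + _]] := zeta_lim (fun=> t) (fun=> t) t
    (fun=> t0) (fun=> t0) (cvg_cst _) (cvg_cst _) t0.
  by move=> zm; rewrite (cvg_unique (@norm_hausdorff _ R) (cvg_cst _) zm).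
have chain x y : 0 < q (T x) (T y) ->
    [/\ zeta (q (T x) (T y)) < eta (q x y), eta (q x y) < zeta (q x y) &
        q (T x) (T y) < q x y].
  move=> Txy; have [_ eta0 xi0] := T_contr _ _ Txy.
  have lt1 := simulation_ge0_lt xi_sim xi_incr (zeta_gt0 _ Txy) eta0 xi0.
  have xy : q x y != 0.
    by apply/eqP => /qdist_eq0 xy; move: Txy; rewrite xy qdistxx ltxx.
  have lt2 : eta (q x y) < zeta (q x y).
    by apply: eta_lt => //; exists (x, y).
  split=> //; rewrite ltNge; apply/negP => /zeta_nd.
  rewrite lt_neqAle eq_sym xy.
  by rewrite qdist_ge0 => /(_ isT); lra.
apply: contrapT => noD.
have bad n : exists p : X * X, q p.1 p.2 < l + l / n.+2%:R /\
    l - l / n.+2%:R <= q (T p.1) (T p.2).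
  apply: contrapT => nop; apply: noD; exists (l / n.+2%:R).
    by rewrite divr_gt0.
  move=> x y xy; rewrite ltNge; apply/negP => Txy.
  by apply: nop; exists (x, y).
have {bad}[p Hp] := choice bad.
pose a n := q (T (p n).1) (T (p n).2); pose b n := q (p n).1 (p n).2.
have ln0 : (fun n => l / n.+2%:R) @ \oo --> (0 : R).
  rewrite -(mulr0 l); apply: cvgM; first exact: cvg_cst.
  by have := @cvg_harmonic R; rewrite -cvg_shiftS.
have lo : (fun n => l - l / n.+2%:R) @ \oo --> l.
  by rewrite -[X in _ --> X]subr0; apply: cvgB => //; exact: cvg_cst.
have hi : (fun n => l + l / n.+2%:R) @ \oo --> l.
  by rewrite -[X in _ --> X]addr0; apply: cvgD => //; exact: cvg_cst.
have a0 n : 0 < a n.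
  apply: lt_le_trans (Hp n).2; rewrite subr_gt0 ltr_pdivrMr ?ltr0Sn //.
  by rewrite ltr_pMr // ltr1n.
have ab n : a n < b n by have [] := chain _ _ (a0 n).
have b0 n : 0 < b n := lt_trans (a0 n) (ab n).
have al : a @ \oo --> l.
  apply: (squeeze_cvgr _ lo hi); apply: nearW => n; rewrite (Hp n).2.
  exact: ltW (lt_trans (ab n) (Hp n).1).
have bl : b @ \oo --> l.
  apply: (squeeze_cvgr _ lo hi); apply: nearW => n.
  by rewrite (le_trans (Hp n).2 (ltW (ab n))) ltW // (Hp n).1.
have [m [m0 za zb]] := zeta_lim a b l a0 b0 al bl l0.
(* zeta (a n) < eta (b n) < zeta (b n), and both ends tend to m. *)
have eb : (eta \o b) @ \oo --> m.
  apply: (squeeze_cvgr _ za zb); apply: nearW => n /=.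
  by have [/ltW -> /ltW ->] := chain _ _ (a0 n).
have sa n : 0 < (zeta \o a) n by exact: zeta_gt0.
have sb n : 0 < (eta \o b) n.
  by apply: lt_trans (sa n) _; have [] := chain _ _ (a0 n).
have [_ _ /(_ _ _ m sa sb za eb m0)] := xi_sim.
rewrite ltNge => /negP; apply.
apply: (@limf_esup_ge0 nat nat R); first exact: filter_not_empty.
by move=> n; rewrite lee_fin; have [] := T_contr _ _ (a0 n).
Qed.

Lemma finite_gap_contraction (R : realType) (X : Type) (q : quasiMetric R X)
    (I : finType) (w : I -> X -> X) :
  (forall i (l : R), 0 < l -> exists2 d : R, 0 < d &
     forall x y, q x y < l + d -> q (w i x) (w i y) < l - d) ->
  gap_contraction q w.
Proof.
move=> w_gap l l0.
have {w_gap} /choice[d Hd] : forall i, exists d : R, 0 < d /\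
    forall x y, q x y < l + d -> q (w i x) (w i y) < l - d.
  by move=> i; have [d] := w_gap i l l0; exists d.
exists (\big[Num.min/1]_i d i).
  by apply: lt_bigmin => // i _; have [] := Hd i.
move=> i x y xy; have di := bigmin_le 1 i d.
by have [_ /(_ x y)] := Hd i; lra.
Qed.

Theorem theorem4p5 (R : realType) (X : pointedType) (q : quasiMetric R X)
  (q_sym : delta_symmetric q) (q_complete : f_complete q)
  (N : nat) (N_gt0 : (0 < N)%N) (w : 'I_N -> X -> X)
  (xi : 'I_N -> R -> R -> R) (zeta : R -> R) (eta : 'I_N -> R -> R)
  (xi_sim : forall i, simulation_function (xi i))
  (w_contr : forall i, proinov_Zcontraction q (xi i) zeta (eta i) (w i))
  (xi_decr : forall i (s1 s2 t : R), 0 <= s1 -> s1 <= s2 -> 0 <= t ->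
     xi i s2 t <= xi i s1 t)
  (xi_incr : forall i (s t1 t2 : R), 0 <= s -> 0 <= t1 -> t1 <= t2 ->
     xi i s t1 <= xi i s t2)
  (zeta_nd : forall t1 t2 : R, 0 < t1 -> t1 <= t2 -> zeta t1 <= zeta t2)
  (eta_nd : forall i (t1 t2 : R), 0 < t1 -> t1 <= t2 -> eta i t1 <= eta i t2)
  (eta_lt_zeta : forall i (t : R), qrange q t -> t != 0 -> eta i t < zeta t)
  (zeta_lim : forall (x y : nat -> R) (l : R),
     (forall n, 0 < x n) -> (forall n, 0 < y n) ->
     x @ \oo --> l -> y @ \oo --> l -> 0 < l ->
     exists m : R, [/\ 0 < m, (zeta \o x) @ \oo --> m &
                       (zeta \o y) @ \oo --> m]) :
  exists A' : set X,
    [/\ Hf q A', fractal_operator w A' = A',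
        (forall B, Hf q B -> fractal_operator w B = B -> B = A') &
        (forall A, Hf q A ->
           Hf_converges q (fun n => iter n (fractal_operator w) A) A')].
Proof.
apply: gap_contraction_attractor => //; apply: finite_gap_contraction => i.
exact: proinov_gap (xi_sim i) (w_contr i) (xi_incr i) zeta_nd zeta_lim.
Qed.
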